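(* Let $\mathcal X$ be a minimal subshift of $A^{\mathbb Z}$, $A$ a finite alphabet. If $\mathcal X$ satisfies the tree condition, then $G(\mathcal X)$ is a free profinite group of rank $M$, where $M$ is the number of letters occurring in $\mathcal X$.
   Context: Subshifts. $A$ is a finite set with the discrete topology, $A^{\mathbb Z}$ has the product topology, and $\sigma((x_i)_{i\in\mathbb Z})=(x_{i+1})_{i\in\mathbb Z}$ is the shift. A subshift of $A^{\mathbb Z}$ is a nonempty closed $\mathcal X\subseteq A^{\mathbb Z}$ with $\sigma(\mathcal X)=\mathcal X$; it is minimal if it contains no proper subshift. $L(\mathcal X)\subseteq A^+$ is the set of finite blocks $x_ix_{i+1}\cdots x_j$ ($i\le j$) of elements $x\in\mathcal X$. $\mathcal X$ is irreducible if for all $u,v\in L(\mathcal X)$ there is $w\in A^+$ with $uwv\in L(\mathcal X)$; minimal subshifts are irreducible. The group $G(\mathcal X)$. Let $\overline{\Omega}_A\mathsf S$ be the free profinite semigroup generated by $A$; it contains the free semigroup $A^+$ as a dense subsemigroup. For $\mathcal X$ irreducible, let $\overline{L(\mathcal X)}$ be the closure of $L(\mathcal X)$ in $\overline{\Omega}_A\mathsf S$. It contains a unique regular $\mathcal J$-class $J(\mathcal X)$ such that every element of $\overline{L(\mathcal X)}$ is a factor of every element of $J(\mathcal X)$. The maximal subgroups of $J(\mathcal X)$ are isomorphic profinite groups, and $G(\mathcal X)$ denotes the corresponding abstract profinite group. Tree condition. For $w\in L(\mathcal X)\cup\{1\}$ (where $1$ is the empty word) let $L_w=\{a\in A\mid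 aw\in L(\mathcal X)\}$, $R_w=\{a\in A\mid wa\in L(\mathcal X)\}$, $E_w=\{(a,b)\in A\times A\mid awb\in L(\mathcal X)\}$. The extension graph of $w$ is the bipartite undirected graph whose vertex set is the union of disjoint copies of $L_w$ and $R_w$, and whose edges are the pairs $(a,b)\in E_w$, the edge $(a,b)$ joining $a\in L_w$ and $b\in R_w$. The subshift $\mathcal X$ satisfies the tree condition if the extension graph of $w$ is a tree for every $w\in L(\mathcal X)\cup\{1\}$. *)

(* Defs.v *)
From HB Require Import structures.
From mathcomp Require Import all_boot all_order all_algebra.
From mathcomp Require Import all_classical topology.

Set Implicit Arguments.
Unset Strict Implicit.
Unset Printing Implicit Defensive.

Local Open Scope classical_set_scope.

HB.mixin Record isTopologicalSemigroup S & Topological S & Semigroup S := {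
  mulg_continuous : continuous (fun p : S * S => (p.1 * p.2)%g)
}.

#[short(type="topologicalSemigroupType")]
HB.structure Definition TopologicalSemigroup :=
  {S of Topological S & Semigroup S & isTopologicalSemigroup S}.

HB.mixin Record isTopologicalGroup G & Topological G & Group G := {
  invg_continuous : continuous (fun x : G => x^-1%g)
}.

#[short(type="topologicalGroupType")]
HB.structure Definition TopologicalGroup :=
  {G of TopologicalSemigroup G & Group G & isTopologicalGroup G}.

Definition finite_discrete (T : topologicalType) : Prop :=
  finite_set [set: T] /\ forall U : set T, open U.

Definition continuous_hom (S T : topologicalSemigroupType) (g : S -> T) : Prop :=
  continuous g /\ {morph g : x y / (x * y)%g}.

(* A compact (Hausdorff) semigroup whose points are separated by its continuous
   finite images; equivalently, an inverse limit of finite semigroups. *)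
Definition profinite_semigroup (S : topologicalSemigroupType) : Prop :=
  [/\ compact [set: S], hausdorff_space S &
      forall s t : S, s <> t ->
        exists (T : topologicalSemigroupType) (g : S -> T),
          [/\ finite_discrete T, continuous_hom g & g s <> g t]].

Definition profinite_group (G : topologicalGroupType) : Prop :=
  [/\ compact [set: G], hausdorff_space G &
      forall s t : G, s <> t ->
        exists (T : topologicalGroupType) (g : G -> T),
          [/\ finite_discrete T, continuous_hom g & g s <> g t]].

Definition free_profinite_semigroup (B : Type) (F : topologicalSemigroupType)
    (eta : B -> F) : Prop :=
  profinite_semigroup F /\
  forall S : topologicalSemigroupType, profinite_semigroup S ->
  forall f : B -> S,
    exists! g : F -> S, continuous_hom g /\ forall b, g (eta b) = f b.

Definition free_profinite_group (B : Type) (F : topologicalGroupType)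
    (eta : B -> F) : Prop :=
  profinite_group F /\
  forall G : topologicalGroupType, profinite_group G ->
  forall f : B -> G,
    exists! g : F -> G, continuous_hom g /\ forall b, g (eta b) = f b.

Definition free_profinite_group_of_rank (M : nat) (G : topologicalGroupType) :
    Prop :=
  exists eta : 'I_M -> G, free_profinite_group eta.

Section Green.
Variable S : semigroupType.
Implicit Types (x y : S) (J H : set S).

Definition factor x y : Prop :=
  [\/ y = x, exists u, y = (u * x)%g, exists v, y = (x * v)%g |
      exists u v, y = (u * x * v)%g].

Definition J_class J : Prop :=
  exists x, J = [set y | factor x y /\ factor y x].

Definition regular_element x : Prop := exists y, (x * y * x)%g = x.

Definition regular_J_class J : Prop :=
  J_class J /\ exists2 x, J x & regular_element x.

Definition subgroup_of_semigroup H : Prop :=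
  (forall x y, H x -> H y -> H (x * y)%g) /\
  exists e, H e /\ forall x, H x ->
    [/\ (e * x)%g = x, (x * e)%g = x &
        exists y, [/\ H y, (x * y)%g = e & (y * x)%g = e]].

Definition maximal_subgroup H : Prop :=
  subgroup_of_semigroup H /\
  forall K, subgroup_of_semigroup K -> H `<=` K -> K = H.

End Green.

(* [j] identifies the topological group [G] with the subset [H] of [S], endowed
   with the multiplication and the topology induced by [S]. *)
Definition topological_group_iso (S : topologicalSemigroupType)
    (G : topologicalGroupType) (H : set S) (j : G -> S) : Prop :=
  [/\ injective j, range j = H, {morph j : x y / (x * y)%g} &
      forall U : set G, open U <-> exists2 V : set S, open V & U = j @^-1` V].

Section Subshift.
Variable A : finType.
Implicit Types (x : int -> A) (X Y : set (int -> A)) (u w : seq A).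

Definition shift x : int -> A := fun i => x (i + 1)%R.

Definition subshift X : Prop :=
  [/\ X !=set0, closed (X : set {ptws int -> discrete_topology A}) &
      shift @` X = X].

Definition minimal_subshift X : Prop :=
  subshift X /\ forall Y, subshift Y -> Y `<=` X -> Y = X.

Definition block x (i : int) (n : nat) : seq A :=
  [seq x (i + k%:Z)%R | k <- iota 0 n].

Definition language X : set (seq A) :=
  [set u | exists x i n, X x /\ u = block x i n.+1].

Definition letters X : {pred A} :=
  [pred a | `[< exists x i, X x /\ x i = a >]].

Definition left_ext X w : set A := [set a | language X (a :: w)].
Definition right_ext X w : set A := [set b | language X (rcons w b)].
Definition bi_ext X w : set (A * A) :=
  [set ab | language X (ab.1 :: rcons w ab.2)].

(* [inl] and [inr] tag the two disjoint copies of the alphabet. *)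
Definition ext_vertices X w : set (A + A) :=
  [set p | match p with
           | inl a => left_ext X w a
           | inr b => right_ext X w b
           end].

Definition ext_adj X w : rel (A + A) := fun p q =>
  match p, q with
  | inl a, inr b => `[< bi_ext X w (a, b) >]
  | inr b, inl a => `[< bi_ext X w (a, b) >]
  | _, _ => false
  end.

End Subshift.

(* [V] is the vertex set of a simple graph with symmetric irreflexive adjacency
   [e], whose edges join elements of [V]. A cycle of length 2 traverses a single
   edge back and forth, so only longer ones are genuine. *)
Definition is_tree (T : finType) (V : set T) (e : rel T) : Prop :=
  [/\ V !=set0, forall p q, V p -> V q -> connect e p q &
      forall c : seq T, ucycle e c -> size c <= 2].

Definition tree_condition (A : finType) (X : set (int -> A)) : Prop :=
  forall w : seq A, w = [::] \/ language X w ->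
    is_tree (ext_vertices X w) (ext_adj X w).

Section JClass.
Variables (A : finType) (F : topologicalSemigroupType) (eta : A -> F).

(* The image in [F] of the nonempty word [a :: u]. *)
Definition word_value (a : A) (u : seq A) : F :=
  foldl (fun s b => s * eta b)%g (eta a) u.

Definition language_image (X : set (int -> A)) : set F :=
  [set word_value w.1 w.2 | w in [set w | language X (w.1 :: w.2)]].

(* [J] is the J-class J(X), where [F] is the free profinite semigroup on [A]. *)
Definition subshift_J_class (X : set (int -> A)) (J : set F) : Prop :=
  [/\ regular_J_class J, J `<=` closure (language_image X) &
      forall x y, closure (language_image X) x -> J y -> factor x y].

End JClass.

(* Main.v *)
Require Import Defs.
From HB Require Import structures.
From mathcomp Require Import all_boot all_order all_algebra.
From mathcomp Require Import finmap all_classical topology.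
From mathcomp Require Import zify.

(** Let e be the identity of the maximal subgroup H, so that H is the group of
    units of the monoid eFe. Everything is read off the finite continuous images
    of F, and two facts suffice.
    - If chi is a continuous homomorphism from F to a finite group, then chi(H)
      contains the images of the letters of X (letters_in_image).
    - Every continuous homomorphism from F to a finite semigroup is, on H, a
      function of a continuous homomorphism from F to a finite group
      (image_determined_by_group).
    By the first fact and compactness there is, for each letter a of X, an
    element of H that no homomorphism to a finite group distinguishes from a.
    These elements form the basis: a map from the letters of X to a profinite
    group P extends to F, and its restriction to H takes the prescribed values on
    the basis because the finite images of P separate its points. The extension
    is unique: H lies in the closure of the words of X, so that, in each finite
    group image of F, an element of H agrees with a product of basis elements,
    and by the second fact these images determine it.

    To prove the two facts, fix a continuous homomorphism phi from F to a finite
    semigroup. There is a word s of X with phi(s) = phi(e) such that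
    phi(e)phi(u) lies in phi(H) for every return u to s, that is, whenever su
    is a word of X that ends with s (returns_into_units): along words s tending
    to e, the equations su = ys pass to the limit as ex = ye, and such an element
    ex of the closure of the words of X is a unit of eFe. By minimality, every
    word z of X of some length N can be written as U s V, and phi(e)phi(V) is
    well defined up to left multiplication by phi(H). Reading one more letter
    after z thus defines a labelling of the words of length N + 1 of X by elements
    of the finite group phi(H): a cocycle on the graph whose vertices are the
    words of length N and whose edges are the words of length N + 1.

    The tree condition controls such cocycles, because the extension graphs of the
    words of length n describe the passage from length n to length n + 1. Since
    they are acyclic, every labelling of the words of length N + 1 by a group is
    cohomologous to one that depends on the last letter alone
    (labelling_cohomologous_to_letters); this yields the second fact, for the
    homomorphism from F to phi(H) given by the labels of the letters. Since they
    are connected, a map on the words of length N that is equivariant under the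
    action of the letters is constant (equivariant_map_constant); applied to the
    cosets of chi(H), this yields the first fact. *)

Set Implicit Arguments.
Unset Strict Implicit.
Unset Printing Implicit Defensive.

Local Open Scope classical_set_scope.

(** * Limits along ultrafilters *)

Lemma ultra_filter_fmap (I S : Type) (V : set_system I) (f : I -> S) :
  UltraFilter V -> UltraFilter (f @ V).
Proof.
move=> UV; split; first exact: fmap_proper_filter.
move=> W PW VW; apply/seteqP; split; last exact: VW.
move=> A WA; have [//|VnA] := in_ultra_setVsetC (f @^-1` A) UV.
have /VW WnA : (f @ V) (~` A) by [].
by have := filterI WA WnA; rewrite setICr => W0; have [] := @filter_ex _ W PW _ (W0 _).
Qed.

Lemma ultra_lim (I : Type) (V : set_system I) (S : topologicalType)
    {UV : UltraFilter V} (f : I -> S) (C : set S) :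
  compact C -> V (f @^-1` C) -> exists p, C p /\ f @ V --> p.
Proof.
rewrite compact_ultra => cC VC.
have UW := @ultra_filter_fmap _ _ _ f UV.
by have [p [Cp fp]] := cC _ UW VC; exists p.
Qed.

Lemma cvg_mulg (S : topologicalSemigroupType) (I : Type) (V : set_system I)
    {FV : Filter V} (f g : I -> S) (x y : S) :
  f @ V --> x -> g @ V --> y -> (fun i => (f i * g i)%g) @ V --> (x * y)%g.
Proof.
move=> fx gy.
by apply: (@continuous2_cvg _ _ _ _ _ _ _ _ (fun a b => (a * b)%g) x y _ fx gy);
  exact: (mulg_continuous (x, y)).
Qed.

Lemma eventually_eq_lim (S : topologicalType) (I : Type) (V : set_system I)
    {PV : ProperFilter V} (f g : I -> S) (x y : S) : hausdorff_space S ->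
  f @ V --> x -> g @ V --> y -> V [set i | f i = g i] -> x = y.
Proof.
move=> hS fx gy fg.
have fy : f @ V --> y.
  move=> B /gy gB; apply: (@filterS2 _ V _ _ _ _ _ fg gB) => i /= fgi gBi.
  by rewrite fgi.
exact: (cvg_unique hS fx fy).
Qed.

Lemma eventually_eq_finite_image (S T : topologicalType) (I : Type) (V : set_system I)
    {FV : Filter V} (f : I -> S) (x : S) (phi : S -> T) : continuous phi ->
  finite_discrete T -> f @ V --> x -> V [set i | phi (f i) = phi x].
Proof.
move=> cphi [_ oT] fx.
apply: (fx [set y | phi y = phi x]).
apply: (cphi x [set z | z = phi x]); apply: open_nbhs_nbhs.
by split => //; exact: oT.
Qed.

Lemma ultra_continuous (S T : topologicalType) (f : S -> T) :
  (forall (x : S) (V : set_system S), UltraFilter V -> V --> x -> f @ V --> f x) ->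
  continuous f.
Proof.
move=> hf x A fA; apply: contrapT => nA.
have PW : ProperFilter (within (~` (f @^-1` A)) (nbhs x)).
  apply: Build_ProperFilter_ex => B; rewrite /within /= => xB.
  apply: contrapT => nB; apply: nA; apply: filterS xB => y yB /=.
  by apply: contrapT => /yB By; apply: nB; exists y.
have [V [UV sV]] := ultraFilterLemma PW.
have Vx : V --> x by move=> B xB; apply: sV; rewrite /within /=; apply: filterS xB => y.
have VA : V (f @^-1` A) by exact: hf Vx _ fA.
have VnA : V (~` (f @^-1` A)) by apply: sV; rewrite /within /=; exact: nearW.
by have [y []] := filter_ex (filterI VA VnA).
Qed.

Lemma cvg_to_pair (T U : topologicalType) (I : Type) (V : set_system I)
    {FV : Filter V} (f : I -> T * U) (p : T * U) :
  (fun i => (f i).1) @ V --> p.1 -> (fun i => (f i).2) @ V --> p.2 -> f @ V --> p.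
Proof.
move=> c1 c2 B [[P Q] [/= Pp Qp] PQB].
apply: (@filterS2 _ V _ _ _ _ _ (c1 _ Pp) (c2 _ Qp)) => i Pi Qi.
by apply: PQB; split.
Qed.

(** * Subgroups and products as topological groups *)

(** Inversion sends an ultrafilter converging to x to one converging to some y
    with xy = 1, by compactness. *)
Lemma compact_inverse_continuous (G : topologicalSemigroupType) (one : G)
    (inv : G -> G) :
  compact [set: G] -> hausdorff_space G ->
  (forall x, x * inv x = one)%g -> (forall x y, x * y = one -> y = inv x)%g ->
  continuous inv.
Proof.
move=> cG hG mulV invU; apply: ultra_continuous => x V UV Vx.
have [//|y [_ Vy]] := @ultra_lim _ V _ UV inv setT cG; first exact: filterT.
suff <- : y = inv x by [].
apply: invU.
apply: (@eventually_eq_lim G G V _ (fun z => z * inv z)%g (fun=> one)) => //.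
- exact: cvg_mulg.
- exact: cvg_cst.
- by apply: filterS (@filterT _ V _) => z _ /=.
Qed.

Section SubgroupAsGroup.
Variables (S : topologicalSemigroupType) (H : set S).
Hypothesis subH : subgroup_of_semigroup H.

(** The proof that H is a subgroup is an argument, so that the group structure
    which depends on it can be attached to the type. *)
Definition carrier of subgroup_of_semigroup H : Type := set_type H.
Local Notation G := (carrier subH).

HB.instance Definition _ := Topological.on G.

Let e : S := projT1 (cid subH.2).
Let He : H e. Proof. exact: (projT2 (cid subH.2)).1. Qed.
Let eP x : H x ->
  [/\ (e * x)%g = x, (x * e)%g = x &
      exists y, [/\ H y, (x * y)%g = e & (y * x)%g = e]].
Proof. exact: (projT2 (cid subH.2)).2. Qed.

Let el (x : S) (Hx : H x) : G := exist _ x (mem_set Hx).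
Let HV (x : G) : H (val x). Proof. exact: set_valP. Qed.

Let mulG (x y : G) : G := el (subH.1 _ _ (HV x) (HV y)).
Let oneG : G := el He.
Let invP (x : G) : {y | [/\ H y, (val x * y)%g = e & (y * val x)%g = e]}.
Proof. by apply: cid; have [] := eP (HV x). Qed.
Let invG (x : G) : G := el (let: And3 Hy _ _ := projT2 (invP x) in Hy).

Let mulGA : associative mulG.
Proof. by move=> x y z; apply/val_inj/mulgA. Qed.
Let mul1G : left_id oneG mulG.
Proof. by move=> x; apply/val_inj; have [] := eP (HV x). Qed.
Let mulG1 : right_id oneG mulG.
Proof. by move=> x; apply/val_inj; have [] := eP (HV x). Qed.
Let mulVG : left_inverse oneG invG mulG.
Proof. by move=> x; apply/val_inj; have [] := projT2 (invP x). Qed.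
Let mulGV : right_inverse oneG invG mulG.
Proof. by move=> x; apply/val_inj; have [] := projT2 (invP x). Qed.

HB.instance Definition _ := isGroup.Build G mulGA mul1G mulG1 mulVG mulGV.

Let valG : G -> S := val.

Let cont_valG : continuous valG.
Proof. exact: initial_continuous. Qed.

Let mulG_continuous : continuous (fun p : G * G => (p.1 * p.2)%g).
Proof.
apply/continuousP => _ [V oV <-].
have -> : (fun p : G * G => (p.1 * p.2)%g) @^-1` (\val @^-1` V) =
   (fun p : G * G => (valG p.1 * valG p.2)%g) @^-1` V by [].
move: V oV; apply/continuousP => -[x y].
apply: (@cvg_mulg S _ _ _ (fun p : G * G => valG p.1) (fun p => valG p.2)).
  by apply: (@cvg_comp _ _ _ fst valG); [exact: cvg_fst | exact: cont_valG].
by apply: (@cvg_comp _ _ _ snd valG); [exact: cvg_snd | exact: cont_valG].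
Qed.

HB.instance Definition _ := isTopologicalSemigroup.Build G mulG_continuous.

End SubgroupAsGroup.

Section SubgroupAsTopologicalGroup.
Variables (S : topologicalSemigroupType) (H : set S).
Hypothesis subH : subgroup_of_semigroup H.
Hypothesis compactH : compact H.
Hypothesis hausS : hausdorff_space S.

(** The extra arguments carry the proof that inversion is continuous. *)
Definition tcarrier of compact H & hausdorff_space S : Type := carrier subH.
Local Notation G := (tcarrier compactH hausS).

HB.instance Definition _ := TopologicalSemigroup.on G.
HB.instance Definition _ := Group.on G.

Let compactG : compact [set: carrier subH].
Proof.
rewrite compact_ultra => V UV _.
have VH : V ((val : carrier subH -> S) @^-1` H).
  by apply: filterS (@filterT _ V _) => x _; exact: set_valP.
have [p [Hp Vp]] := ultra_lim compactH VH.
exists (exist _ p (mem_set Hp)); split => //=.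
move=> A [_ [[B oB <-] /= Bp BA]].
by apply: filterS BA _; apply: Vp; exact: open_nbhs_nbhs.
Qed.

Let hausG : hausdorff_space (carrier subH).
Proof.
move=> x y xy; apply/val_inj/hausS => A B Ax By.
have [z [Az Bz]] := xy _ _ (@initial_continuous _ _ (\val : set_type H -> S) x _ Ax)
  (@initial_continuous _ _ (\val : set_type H -> S) y _ By).
by exists (\val z).
Qed.

Let invG_continuous : continuous (fun x : carrier subH => x^-1%g).
Proof.
apply: (@compact_inverse_continuous (carrier subH) 1%g (fun x => x^-1)%g) => //.
- by move=> x; rewrite mulgV.
- by move=> x y xy; rewrite -[y]mul1g -(mulVg x) -mulgA xy mulg1.
Qed.

HB.instance Definition _ := isTopologicalGroup.Build G invG_continuous.

Lemma compact_subgroup_group :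
  exists (G : topologicalGroupType) (j : G -> S),
    [/\ topological_group_iso H j, compact [set: G] & hausdorff_space G].
Proof.
exists G, (\val : set_type H -> S); split => //; split => //.
- apply/seteqP; split => x /=; first by move=> [y _ <-]; exact: set_valP.
  by move=> Hx; exists (exist _ x (mem_set Hx)).
- move=> U; split; first by move=> [V oV <-]; exists V.
  by move=> [V oV ->]; exists V.
Qed.

End SubgroupAsTopologicalGroup.

Lemma image_subgroup (S T : semigroupType) (phi : S -> T) (H : set S) :
  {morph phi : x y / (x * y)%g} -> subgroup_of_semigroup H ->
  subgroup_of_semigroup (phi @` H).
Proof.
move=> phiM [HM [e [He eP]]]; split.
  move=> _ _ [x Hx <-] [y Hy <-]; exists (x * y)%g; first exact: HM.
  by rewrite phiM.
exists (phi e); split; first by exists e.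
move=> _ [x Hx <-]; have [ex xe [y [Hy xy yx]]] := eP x Hx.
rewrite -!phiM ex xe; split => //; exists (phi y).
by rewrite -!phiM xy yx; split => //; exists y.
Qed.

Lemma topological_group_iso_finite_discrete (S : topologicalSemigroupType)
    (G : topologicalGroupType) (H : set S) (j : G -> S) :
  finite_discrete S -> topological_group_iso H j -> finite_discrete G.
Proof.
move=> [finS oS] [jI _ _ jtop]; split.
  have -> : [set: G] = j @^-1` [set: S] by [].
  by apply: finite_preimage finS => x y _ _; exact: jI.
move=> U; apply/jtop; exists (j @` U) => //.
apply/seteqP; split => [x Ux|x [y Uy /jI <-]] //; by exists x.
Qed.

Section ProductGroup.
Variables K1 K2 : topologicalGroupType.
Local Notation K := (K1 * K2)%type.

Let fst_cont (I : Type) (V : set_system I) {FV : Filter V} (f : I -> K) (p : K) :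
  f @ V --> p -> (fun i => (f i).1) @ V --> p.1.
Proof. by move=> fp; apply: (cvg_comp _ fst fp); exact: cvg_fst. Qed.

Let snd_cont (I : Type) (V : set_system I) {FV : Filter V} (f : I -> K) (p : K) :
  f @ V --> p -> (fun i => (f i).2) @ V --> p.2.
Proof. by move=> fp; apply: (cvg_comp _ snd fp); exact: cvg_snd. Qed.

Let pair_mulg_continuous : continuous (fun p : K * K => (p.1 * p.2)%g).
Proof.
move=> p.
have c1 : (fun q : K * K => q.1) @ nbhs p --> p.1 by exact: cvg_fst.
have c2 : (fun q : K * K => q.2) @ nbhs p --> p.2 by exact: cvg_snd.
apply: cvg_to_pair.
  exact: (cvg_mulg (fst_cont c1) (fst_cont c2)).
exact: (cvg_mulg (snd_cont c1) (snd_cont c2)).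
Qed.

HB.instance Definition _ :=
  isTopologicalSemigroup.Build (K1 * K2)%type pair_mulg_continuous.

Let pair_invg_continuous : continuous (fun x : K => x^-1%g).
Proof.
move=> x; apply: cvg_to_pair.
  apply: (@cvg_comp _ _ _ (fun y : K => y.1) (fun y => y^-1)%g _ (nbhs x.1)).
    exact: cvg_fst.
  exact: invg_continuous.
apply: (@cvg_comp _ _ _ (fun y : K => y.2) (fun y => y^-1)%g _ (nbhs x.2)).
  exact: cvg_snd.
exact: invg_continuous.
Qed.

HB.instance Definition _ :=
  isTopologicalGroup.Build (K1 * K2)%type pair_invg_continuous.

Lemma finite_discrete_pair :
  finite_discrete K1 -> finite_discrete K2 -> finite_discrete (K1 * K2)%type.
Proof.
move=> [f1 o1] [f2 o2]; split.
  by rewrite -setXTT; exact: finite_setX.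
move=> U; rewrite openE => -[x y] Uxy; exists ([set x], [set y]) => /=.
  by split; apply: open_nbhs_nbhs; split; [exact: o1 | | exact: o2 | ].
by move=> [x' y'] [/= -> ->].
Qed.

End ProductGroup.

(** * Finite images of profinite semigroups *)

Lemma finite_discrete_compact (T : topologicalType) :
  finite_discrete T -> compact [set: T].
Proof. by move=> [fT _]; exact: finite_compact. Qed.

Lemma finite_discrete_hausdorff (T : topologicalType) :
  finite_discrete T -> hausdorff_space T.
Proof.
move=> [_ oT] x y /(_ [set x] [set y]) [].
- by apply: open_nbhs_nbhs; split => //; exact: oT.
- by apply: open_nbhs_nbhs; split => //; exact: oT.
- by move=> z [-> ->].
Qed.

Lemma finite_discrete_profinite_semigroup (T : topologicalSemigroupType) :
  finite_discrete T -> profinite_semigroup T.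
Proof.
move=> fT; split.
- exact: finite_discrete_compact.
- exact: finite_discrete_hausdorff.
- by move=> s t st; exists T, id; split => //; split => // x; exact: cvg_id.
Qed.

Lemma profinite_group_semigroup (P : topologicalGroupType) :
  profinite_group P -> profinite_semigroup P.
Proof.
move=> [cP hP sP]; split => // s t /sP [T [g [fT cg gst]]].
by exists T, g.
Qed.

Lemma free_profinite_extend (B : Type) (F S : topologicalSemigroupType)
    (eta : B -> F) (f : B -> S) :
  free_profinite_semigroup eta -> profinite_semigroup S ->
  exists g : F -> S, continuous_hom g /\ forall b, g (eta b) = f b.
Proof. by move=> [_ freeF] /freeF /(_ f) [g [gP _]]; exists g. Qed.

Section DiscreteSemigroup.
Variables (T : choiceType) (op : T -> T -> T).
Hypothesis opA : associative op.

(** The proof of associativity is an argument for the same reason as in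
    carrier. *)
Definition discrete_semigroup of associative op : Type := discrete_topology T.
Local Notation D := (discrete_semigroup opA).

HB.instance Definition _ := Topological.on D.
HB.instance Definition _ := isSemigroup.Build D opA.

Let op_continuous : continuous (fun p : D * D => (p.1 * p.2)%g).
Proof.
move=> [x y] B /nbhs_singleton Bxy.
exists ([set x], [set y]) => /=; last by move=> [u v] [/= -> ->].
by split; exact: (@discrete_set1 (discrete_topology T)).
Qed.

HB.instance Definition _ := isTopologicalSemigroup.Build D op_continuous.

Lemma discrete_semigroup_open (U : set D) : open U.
Proof. exact: (@discrete_open (discrete_topology T)). Qed.

End DiscreteSemigroup.

(** The elements of F thereby inherit any finite invariant of words that is
    compatible with concatenation. *)
Lemma free_profinite_extend_finite (B : Type) (F : topologicalSemigroupType)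
    (eta : B -> F) (T : finType) (op : T -> T -> T) (f : B -> T) :
  free_profinite_semigroup eta -> associative op ->
  exists g : F -> T, [/\ forall x y, g (x * y)%g = op (g x) (g y),
    forall t, open [set x | g x = t] & forall b, g (eta b) = f b].
Proof.
move=> freeF opA; pose D : topologicalSemigroupType := discrete_semigroup opA.
have fD : finite_discrete D.
  by split; [exact: finite_finset | exact: discrete_semigroup_open].
have [g [[cg gM] gf]] :=
  @free_profinite_extend _ F D _ f freeF (finite_discrete_profinite_semigroup fD).
exists g; split => // t.
have -> : [set x | g x = t] = g @^-1` [set t] by [].
by apply: open_comp; [move=> ? _; exact: cg | exact: discrete_semigroup_open].
Qed.

(** The conditions chi(m x) = chi(y) are closed, and any two of them are
    implied by a third one, because a product of finite groups is a finite
    group. *)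
Lemma compact_realizes_finite_images (F : topologicalSemigroupType)
    (Z : topologicalType) (m : Z -> F) (C : set Z) (y : F) :
  continuous m -> compact C -> C !=set0 ->
  (forall (K : topologicalGroupType) (chi : F -> K), finite_discrete K ->
     continuous_hom chi -> exists2 x, C x & chi (m x) = chi y) ->
  exists2 x, C x & forall (K : topologicalGroupType) (chi : F -> K),
    finite_discrete K -> continuous_hom chi -> chi (m x) = chi y.
Proof.
move=> cm cC C0 realize.
(* The full set keeps the family nonempty. *)
pose D : set (set F) := [set B | B = setT \/
  exists (K : topologicalGroupType) (chi : F -> K),
  [/\ finite_discrete K, continuous_hom chi & B = [set x | chi x = chi y]]].
have PF : ProperFilter (filter_from D (fun B => C `&` m @^-1` B)).
  apply: filter_from_proper; last first.
    move=> _ [->|[K [chi [fK hchi ->]]]]; first by rewrite preimage_setT setIT.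
    by have [x Cx xy] := realize K chi fK hchi; exists x.
  apply: filter_from_filter; first by exists setT; left.
  move=> B1 B2 [->|D1]; first by move=> D2; exists B2; rewrite ?preimage_setT ?setIT //
     => x [Cx].
  move=> [->|D2]; first by exists B1; [right | rewrite preimage_setT setIT => x []].
  move: D1 D2 => [K1 [chi1 [f1 [c1 h1] ->]]] [K2 [chi2 [f2 [c2 h2] ->]]].
  exists [set x | (chi1 x, chi2 x) = (chi1 y, chi2 y) :> (K1 * K2)%type].
    right; exists (K1 * K2)%type, (fun x => (chi1 x, chi2 x)); split => //.
      exact: finite_discrete_pair.
    split; last by move=> x x'; rewrite h1 h2.
    by move=> x; apply: cvg_to_pair; [exact: c1 | exact: c2].
  by move=> x [Cx /= [e1 e2]].
have FC : filter_from D (fun B => C `&` m @^-1` B) C.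
  by exists setT; [left | move=> x []].
have [x [Cx xcl]] := cC _ PF FC.
exists x => // K chi fK [cchi hchi].
have nx : nbhs x [set z | chi (m z) = chi (m x)].
  have := @eventually_eq_finite_image F K Z (nbhs x) _ m (m x) chi cchi fK.
  by apply; exact: cm.
have FB : filter_from D (fun B => C `&` m @^-1` B) (C `&` m @^-1` [set z | chi z = chi y]).
  by exists [set z | chi z = chi y] => //; right; exists K, chi.
by have [z [[_ /= <-] /= ->]] := xcl _ _ FB nx.
Qed.

(** * Maximal subgroups of profinite semigroups *)

(** If the powers of y were distinct the semigroup would be infinite, so some
    power of y is the identity. *)
Lemma finite_one_sided_inverse (T : semigroupType) (a y eps : T) :
  finite_set [set: T] -> (eps * eps)%g = eps -> (eps * y)%g = y ->
  (a * eps)%g = a -> (a * y)%g = eps -> (y * a)%g = eps.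
Proof.
move=> finT epsK epsy aeps ay.
(* p n is the n-th power of y in the monoid with identity eps, and a undoes one
   multiplication by y. *)
pose p n := iter n (fun t => y * t)%g eps.
have epsp n : (eps * p n)%g = p n by case: n => //= n; rewrite mulgA epsy.
have ap n : (a * p n.+1)%g = p n by rewrite /= mulgA ay epsp.
have [i [j [ij pij]]] : exists i j, (i < j)%N /\ p i = p j.
  pose s := map p (iota 0 (size (enum_fset (fset_set [set: T]))).+1).
  have /(uniqPn eps) [i [j [ij]]] : ~~ uniq s.
    apply/negP => us; have := @uniq_leq_size _ s (enum_fset (fset_set [set: T])) us.
    rewrite size_map size_iota ltnn => H; suff : false by []; apply: H => t _.
    have : t \in fset_set [set: T] by rewrite in_fset_set // inE.
    by [].
  rewrite size_map size_iota => js.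
  rewrite !(nth_map 0) ?size_iota // ?nth_iota //; try exact: ltn_trans js.
  by exists i, j.
have p0 : forall i j, p i = p (i + j)%N -> eps = p j.
  by elim=> [//|i' IH] j' /(congr1 (fun t => a * t)%g); rewrite addSn !ap => /IH.
have : eps = p (j - i)%N by apply: (p0 i); rewrite subnKC // ltnW.
case: (j - i)%N (subn_gt0 i j) => [|m]; first by rewrite ij.
move=> _ epsE; rewrite -[X in (y * X)%g]aeps [in X in (y * X)%g]epsE ap.
by rewrite epsE.
Qed.

(** For an idempotent e, this is the group of units of the monoid eSe. *)
Definition units_at (S : semigroupType) (e : S) : set S :=
  [set z | [/\ (e * z = z)%g, (z * e = z)%g &
    exists w, [/\ (e * w = w)%g, (w * e = w)%g, (z * w = e)%g & (w * z = e)%g]]].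

Lemma subgroup_units_at (S : semigroupType) (e : S) :
  (e * e = e)%g -> subgroup_of_semigroup (units_at e).
Proof.
move=> ee; split=> [x y [ex xe [v [ev ve xv vx]]] [ey ye [w [ew we yw wy]]]|].
  split; [by rewrite mulgA ex | by rewrite -mulgA ye | exists (w * v)%g; split].
  - by rewrite mulgA ew.
  - by rewrite -mulgA ve.
  - by rewrite -mulgA (mulgA y) yw ev.
  - by rewrite -mulgA (mulgA v) vx ey.
exists e; split; first by split => //; exists e.
move=> x [ex xe [w [ew we xw wx]]]; split => //.
by exists w; split => //; split => //; exists x.
Qed.

Lemma maximal_subgroup_units (S : semigroupType) (H : set S) :
  maximal_subgroup H -> exists e, (e * e = e)%g /\ H = units_at e.
Proof.
move=> [[HM [e [He eP]]] maxH]; have [ee _ _] := eP e He.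
exists e; split => //; apply/esym/maxH; first exact: subgroup_units_at.
move=> x Hx; have [ex xe [w [Hw xw wx]]] := eP x Hx.
by have [ew we _] := eP w Hw; split => //; exists w.
Qed.

Section Profinite.
Variable F : topologicalSemigroupType.
Hypothesis proF : profinite_semigroup F.
Variable e : F.
Hypothesis eK : (e * e = e)%g.

Lemma profinite_one_sided_inverse (a y : F) : (e * y = y)%g -> (a * e = a)%g ->
  (a * y = e)%g -> (y * a = e)%g.
Proof.
have [_ _ sepF] := proF.
move=> ey ae ay; apply: contrapT => /sepF [T [g [[fT _] [_ gM] []]]].
rewrite gM (@finite_one_sided_inverse T (g a) (g y) (g e)) // -gM ?eK ?ey ?ae//.
by rewrite ay.
Qed.

(** If e = azb with z in eFe, then eae and ebe provide one-sided inverses of zb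
    and az in eFe; one-sided inverses in eFe are two-sided because they are so in
    finite images. *)
Lemma units_at_factor (z a b : F) : (e * z = z)%g -> (z * e = z)%g ->
  (e = a * z * b)%g -> units_at e z.
Proof.
move=> ez ze azb; split => //.
pose a' := (e * a * e)%g; pose b' := (e * b * e)%g.
have ea' : (e * a' = a')%g by rewrite /a' !mulgA eK.
have a'e : (a' * e = a')%g by rewrite /a' -!mulgA eK.
have eb' : (e * b' = b')%g by rewrite /b' !mulgA eK.
have b'e : (b' * e = b')%g by rewrite /b' -!mulgA eK.
have azb' : (a' * (z * b') = e)%g.
  rewrite /a' /b' -!mulgA (mulgA e z) ez (mulgA z e) ze.
  by rewrite (mulgA z) (mulgA a) (mulgA a) -azb eK eK.
have zba : (z * b' * a' = e)%g.
  by apply: profinite_one_sided_inverse => //; rewrite mulgA ez.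
have baz : (b' * (a' * z) = e)%g.
  by apply: profinite_one_sided_inverse; rewrite // -mulgA ?ze // mulgA.
exists (b' * a')%g; split.
- by rewrite mulgA eb'.
- by rewrite -mulgA a'e.
- by rewrite mulgA.
- by rewrite -mulgA.
Qed.

(** When units converge along an ultrafilter, so do their inverses, by
    compactness of F, and the two limits are inverse to each other. *)
Lemma compact_units_at : compact (units_at e).
Proof.
have [cF hF _] := proF; rewrite compact_ultra => V UV VU.
have [z [_ Vz]] : exists z : F, setT z /\ id @ V --> z.
  by apply: (@ultra_lim _ V F _ _ setT cF); apply: filterS (@filterT _ V _).
pose inv x := xget e [set w | [/\ (e * w = w)%g, (w * e = w)%g, (x * w = e)%g &
  (w * x = e)%g]].
have invP x : units_at e x -> [/\ (e * inv x = inv x)%g, (inv x * e = inv x)%g,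
    (x * inv x = e)%g & (inv x * x = e)%g].
  by move=> [_ _ [w wP]]; rewrite /inv; case: xgetP => [? _ //|/(_ w)].
have [w [_ Vw]] : exists w : F, setT w /\ inv @ V --> w.
  by apply: (@ultra_lim _ V F _ _ setT cF); apply: filterS (@filterT _ V _).
have Ve : (fun=> e) @ V --> e by exact: cvg_cst.
have lim (f g : F -> F) (x y : F) : f @ V --> x -> g @ V --> y ->
    (forall u, units_at e u -> f u = g u) -> x = y.
  by move=> fx gy fg; apply: (eventually_eq_lim hF fx gy); apply: filterS VU => u /fg.
exists z; split => //; split.
- by apply: (lim (fun u => e * u)%g id) => //; [exact: cvg_mulg|move=> u []].
- by apply: (lim (fun u => u * e)%g id) => //; [exact: cvg_mulg|move=> u []].
- exists w; split.
  + by apply: (lim (fun u => e * inv u)%g inv) => //; [exact: cvg_mulg|move=> u /invP []].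
  + by apply: (lim (fun u => inv u * e)%g inv) => //; [exact: cvg_mulg|move=> u /invP []].
  + by apply: (lim (fun u => u * inv u)%g (fun=> e)) => //; [exact: cvg_mulg|move=> u /invP []].
  + by apply: (lim (fun u => inv u * u)%g (fun=> e)) => //; [exact: cvg_mulg|move=> u /invP []].
Qed.

End Profinite.

(** * Values of words *)

(** Multiplying an element by the letters of u one at a time makes sense for the
    empty word as well, although S may have no identity. *)
Definition act (A : Type) (S : semigroupType) (f : A -> S) (x : S) (u : seq A) : S :=
  foldl (fun s b => s * f b)%g x u.

Section Words.
Variables (A : Type) (S : semigroupType) (f : A -> S).

Lemma act_cat x u v : act f x (u ++ v) = act f (act f x u) v.
Proof. exact: foldl_cat. Qed.

Lemma act_rcons x u b : act f x (rcons u b) = (act f x u * f b)%g.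
Proof. by rewrite -cats1 act_cat. Qed.

Lemma actM x y u : act f (x * y)%g u = (x * act f y u)%g.
Proof. by elim: u y => //= b u IH y; rewrite -IH mulgA. Qed.

(** The argument d is a default value for the empty word. *)
Definition wval (d : S) (u : seq A) : S := if u is a :: u' then act f (f a) u' else d.

Lemma mul_wval d x u : u <> [::] -> (x * wval d u)%g = act f x u.
Proof. by case: u => //= a u _; rewrite -actM. Qed.

Lemma wval_cat d u v : u <> [::] -> wval d (u ++ v) = act f (wval d u) v.
Proof. by case: u => //= a u _; rewrite act_cat. Qed.

End Words.

Lemma act_hom (A : Type) (S T : semigroupType) (f : A -> S) (g : S -> T) x u :
  {morph g : x y / (x * y)%g} -> g (act f x u) = act (g \o f) (g x) u.
Proof. by move=> gM; elim: u x => //= b u IH x; rewrite IH gM. Qed.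

Lemma take_catl (A : Type) N (u v : seq A) : take N (take N u ++ v) = take N (u ++ v).
Proof.
case: (leqP (size u) N) => Nu; first by rewrite (take_oversize Nu).
have sN : size (take N u) = N by rewrite size_takel // ltnW.
by rewrite !takel_cat ?sN ?take_takel // ltnW.
Qed.

Lemma take_catr (A : Type) N (u v : seq A) : take N (u ++ take N v) = take N (u ++ v).
Proof.
rewrite [LHS]take_cat [RHS]take_cat; case: ltnP => // uN; congr (_ ++ _).
by rewrite take_takel // leq_subr.
Qed.

(** Both the prefix and the suffix of length N + 1 of a word are multiplicative
    invariants; the suffix is read from right to left, which reverses the
    multiplication. *)
Lemma prefix_suffix_extend (A : finType) (F : topologicalSemigroupType)
    (eta : A -> F) N :
  free_profinite_semigroup eta ->
  exists p q : F -> seq A, [/\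
    forall x y, p (x * y)%g = take N.+1 (p x ++ p y) /\
      q (x * y)%g = take N.+1 (q y ++ q x),
    forall x, open [set y | p y = p x] /\ open [set y | q y = q x] &
    forall a, p (eta a) = [:: a] /\ q (eta a) = [:: a]].
Proof.
move=> freeF.
have sz (u : seq A) : (size (take N.+1 u) <= N.+1)%N.
  by rewrite size_take_min geq_minl.
pose op (u v : N.+1.-bseq A) : N.+1.-bseq A := Bseq (sz (u ++ v)).
have opA : associative op.
  by move=> u v w; apply/val_inj => /=; rewrite take_catl take_catr catA.
have opA' : associative (fun u v => op v u) by move=> u v w; rewrite opA.
pose one a : N.+1.-bseq A := Bseq (isT : (size [:: a] <= N.+1)%N).
have [p [pM po pe]] := free_profinite_extend_finite one freeF opA.
have [q [qM qo qe]] := free_profinite_extend_finite one freeF opA'.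
have openE (f : F -> N.+1.-bseq A) x : (forall t, open [set y | f y = t]) ->
    open [set y | f y = f x :> seq A].
  move=> fo; have -> : [set y | f y = f x :> seq A] = [set y | f y = f x].
    by apply/seteqP; split => y /= => [/val_inj|->].
  exact: fo.
exists (fun x => bseqval (p x)), (fun x => bseqval (q x)); split.
- by move=> x y; rewrite pM qM.
- by move=> x; split; exact: openE.
- by move=> a; rewrite pe qe.
Qed.

(** * Returns to a word close to an idempotent *)

Lemma longer_prefix (A : Type) (p1 q1 p2 q2 : seq A) :
  p1 ++ q1 = p2 ++ q2 -> (size p2 <= size p1)%N ->
  exists2 r, p1 = p2 ++ r & r ++ q1 = q2.
Proof.
move=> eqpq le21.
have p2E : take (size p2) p1 = p2.
  by have := congr1 (take (size p2)) eqpq; rewrite takel_cat // take_size_cat.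
have p1E : p1 = p2 ++ drop (size p2) p1.
  by rewrite -[LHS](cat_take_drop (size p2)) p2E.
exists (drop (size p2) p1) => //.
have := congr1 (drop (size p2)) eqpq.
by rewrite [in LHS]p1E -catA !drop_size_cat.
Qed.

Section Returns.
Variables (A : choiceType) (F : topologicalSemigroupType) (eta : A -> F).
Variables (L : set (seq A)) (e : F).
Hypothesis proF : profinite_semigroup F.
Hypothesis L0 : ~ L [::].
Hypothesis eK : (e * e = e)%g.
Hypothesis e_cl : closure (wval eta e @` L) e.
Hypothesis cl_factor : forall x, closure (wval eta e @` L) x -> Defs.factor x e.

Lemma idempotent_factor (x : F) : Defs.factor x e -> exists a b, (e = a * x * b)%g.
Proof.
case=> [<-|[a ea]|[b eb]|[a [b eab]]].
- by exists e, e; rewrite !eK.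
- by exists a, e; rewrite -ea eK.
- by exists e, b; rewrite -mulgA -eb eK.
- by exists a, b.
Qed.

(** Otherwise each word s of L close to e has a return u with phi(e)phi(u)
    outside phi(H). Write su = ys and let s tend to e along an ultrafilter: in
    the limit ex = ye, so that ex lies in eFe, and ex is a factor of e as a limit
    of words of L. Hence ex is a unit of eFe, while phi(ex) is the value
    phi(e)phi(u) for some of these u. *)
Lemma returns_into_units (T : topologicalSemigroupType) (phi : F -> T) :
  finite_discrete T -> continuous_hom phi ->
  exists s, [/\ L s, phi (wval eta e s) = phi e &
    forall u, L (s ++ u) -> (exists y, s ++ u = y ++ s) ->
      exists2 g, units_at e g & act (phi \o eta) (phi e) u = phi g].
Proof.
move=> fT [cphi phiM]; have [cF hF _] := proF; apply: contrapT => nex.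
pose good s u := L (s ++ u) /\ (exists y, s ++ u = y ++ s) /\
  ~ (exists2 g, units_at e g & act (phi \o eta) (phi e) u = phi g).
have bad s : L s -> phi (wval eta e s) = phi e -> exists u, good s u.
  move=> Ls se; apply: contrapT => nu; apply: nex; exists s; split => // u Lsu su.
  by apply: contrapT => nhu; apply: nu; exists u.
pose ub s := xget [::] (good s).
pose yb s := xget [::] [set y | s ++ ub s = y ++ s].
(* The sets of words of L with value near e form a filter, refined below to an
   ultrafilter V. *)
have PV : ProperFilter
    (filter_from (nbhs e) (fun B => [set s | L s /\ B (wval eta e s)])).
  apply: filter_from_proper; last first.
    by move=> B /e_cl [_ [[s Ls <-] Bs]]; exists s.
  apply: filter_from_filter; first by exists setT; exact: filterT.
  move=> B C eB eC; exists (B `&` C); first exact: filterI.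
  by move=> s [Ls [Bs Cs]].
have [V [UV sV]] := ultraFilterLemma PV.
have Vs : wval eta e @ V --> e.
  by move=> B eB; apply: sV; exists B => // s [].
have Vgood : V [set s | L s /\ good s (ub s)].
  have VL : V L by apply: sV; exists setT; [exact: filterT | move=> s []].
  apply: (@filterS2 _ V _ _ _ _ _ VL (eventually_eq_finite_image cphi fT Vs)) => s Ls se.
  split => //.
  by have [u gu] := bad s Ls se; rewrite /ub; case: xgetP => [? _ //|/(_ u)].
have nonnil s : L s -> good s (ub s) -> [/\ s <> [::], ub s <> [::], yb s <> [::] &
    s ++ ub s = yb s ++ s].
  move=> Ls [Lsu [[y ys] nh]].
  have e1 : s ++ ub s = yb s ++ s.
    by rewrite /yb; case: xgetP => [? _ //|/(_ y)].
  have ub0 : ub s <> [::].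
    move=> ub0; apply: nh; exists e; last by rewrite ub0.
    by split => //; exists e.
  split=> //; first by move=> s0; rewrite s0 in Ls.
  move=> yb0; apply: ub0; move/(congr1 size): e1; rewrite yb0 size_cat /=.
  by case: (ub s) => //= b v; rewrite -[X in _ = X]addn0 => /addnI.
have [x [_ Vx]] : exists x : F, setT x /\ (wval eta e \o ub) @ V --> x.
  by apply: (@ultra_lim _ V F _ _ setT cF); apply: filterS (@filterT _ V _).
have [y [_ Vy]] : exists y : F, setT y /\ (wval eta e \o yb) @ V --> y.
  by apply: (@ultra_lim _ V F _ _ setT cF); apply: filterS (@filterT _ V _).
have Vex : (fun s => wval eta e s * wval eta e (ub s))%g @ V --> (e * x)%g.
  exact: cvg_mulg Vs Vx.
have exy : (e * x = y * e)%g.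
  have Vye : (fun s => wval eta e (yb s) * wval eta e s)%g @ V --> (y * e)%g.
    exact: cvg_mulg Vy Vs.
  apply: (eventually_eq_lim hF Vex Vye).
  apply: filterS Vgood => s [Ls /(nonnil _ Ls) [s0 u0 y0 e1]] /=.
  by rewrite !mul_wval // -!wval_cat // e1.
have excl : closure (wval eta e @` L) (e * x)%g.
  move=> B /Vex VB; have [s [/= [Ls gs] Bs]] := filter_ex (@filterI _ V _ _ _ Vgood VB).
  exists (wval eta e (s ++ ub s)); split; first by exists (s ++ ub s) => //; case: gs.
  by have [s0 u0 _ _] := nonnil _ Ls gs; rewrite wval_cat // -(mul_wval _ e).
have [a [b ab]] := idempotent_factor (cl_factor excl).
have ex_unit : units_at e (e * x)%g.
  apply: (units_at_factor proF eK _ _ ab); first by rewrite mulgA eK.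
  by rewrite exy -mulgA eK.
have [s [/= [Ls gs] xs]] :=
  filter_ex (@filterI _ V _ _ _ Vgood (eventually_eq_finite_image cphi fT Vx)).
have [s0 u0 _ _] := nonnil _ Ls gs; have [_ [_]] := gs; apply.
by exists (e * x)%g => //; rewrite phiM -xs -phiM mul_wval // act_hom.
Qed.

(** If v1 is the longer of the two, then v1 = u v2 for a return u to s; in the
    other case, invert the unit obtained by exchanging them. *)
Lemma returns_comparable (T : topologicalSemigroupType) (phi : F -> T) s :
  continuous_hom phi ->
  (forall x y z, L (x ++ y ++ z) -> y <> [::] -> L y) ->
  s <> [::] ->
  (forall u, L (s ++ u) -> (exists y, s ++ u = y ++ s) ->
      exists2 g, units_at e g & act (phi \o eta) (phi e) u = phi g) ->
  forall x1 v1 x2 v2, L (x1 ++ s ++ v1) -> x1 ++ s ++ v1 = x2 ++ s ++ v2 ->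
  exists2 g, units_at e g &
    act (phi \o eta) (phi e) v1 = (phi g * act (phi \o eta) (phi e) v2)%g.
Proof.
move=> [_ phiM] Lfact s0 ret.
have main x1 v1 x2 v2 : (size v2 <= size v1)%N ->
    L (x1 ++ s ++ v1) -> x1 ++ s ++ v1 = x2 ++ s ++ v2 ->
    exists2 g, units_at e g &
      act (phi \o eta) (phi e) v1 = (phi g * act (phi \o eta) (phi e) v2)%g.
  move=> le21 Lw eqw.
  have sz12 : (size x1 <= size x2)%N.
    have /eqP := congr1 size eqw; rewrite !size_cat !addnA => /eqP sz.
    rewrite -(leq_add2r (size s)) -(leq_add2r (size v2)) -sz.
    by rewrite leq_add2l.
  have [u x2s v1E] : exists2 u, x2 ++ s = (x1 ++ s) ++ u & v1 = u ++ v2.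
    have eqw' : (x2 ++ s) ++ v2 = (x1 ++ s) ++ v1 by rewrite -!catA.
    have [|u uE <-] := longer_prefix eqw'; last by exists u.
    by rewrite !size_cat leq_add2r.
  have [y x2E yE] : exists2 y, x2 = x1 ++ y & y ++ s = s ++ u.
    by apply: longer_prefix sz12; rewrite x2s catA.
  have [g Hg gu] : exists2 g, units_at e g & act (phi \o eta) (phi e) u = phi g.
    apply: ret; last by exists y.
    apply: (Lfact x1 _ v2); first by rewrite -catA -v1E.
    by case: (s) s0.
  exists g => //; rewrite v1E act_cat gu -actM -phiM.
  by have [_ -> _] := Hg.
move=> x1 v1 x2 v2 Lw eqw; have [le21|/ltnW le12] := leqP (size v2) (size v1).
  exact: main le21 Lw eqw.
have Lw2 : L (x2 ++ s ++ v2) by rewrite -eqw.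
have [g [eg ge [h [eh he gh hg]]] gE] := main _ _ _ _ le12 Lw2 (esym eqw).
exists h; first by split => //; exists g.
by rewrite gE mulgA -phiM hg -actM -phiM eK.
Qed.

End Returns.

(** * Languages of minimal subshifts *)

Section Language.
Variables (A : finType) (X : set (int -> A)).
Local Notation L := (language X).

Lemma size_block (x : int -> A) i n : size (block x i n) = n.
Proof. by rewrite size_map size_iota. Qed.

Lemma block_cat (x : int -> A) (i : int) m n :
  block x i (m + n) = block x i m ++ block x (i + m%:Z)%R n.
Proof.
rewrite /block iotaD map_cat; congr (_ ++ _).
rewrite add0n -[m in iota m n]addn0 iotaDl -map_comp.
by apply: eq_map => k /=; rewrite PoszD GRing.addrA.
Qed.

Lemma languageP w : L w <-> exists x i, [/\ X x, w <> [::] & w = block x i (size w)].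
Proof.
split=> [[x [i [n [Xx ->]]]]|[x [i [Xx w0 wE]]]].
  by exists x, i; split => //; rewrite size_block.
by exists x, i, (size w).-1; split => //; rewrite prednK //; case: (w) w0.
Qed.

Lemma language_cat x y z : L (x ++ y ++ z) -> y <> [::] -> L y.
Proof.
move=> /languageP [t [i [Xt _ eqt]]] y0; apply/languageP.
exists t, (i + (size x)%:Z)%R; split => //; move: eqt.
rewrite !size_cat !block_cat => /eqP; rewrite eqseq_cat ?size_block // => /andP [_].
by rewrite eqseq_cat ?size_block // => /andP [/eqP].
Qed.

Lemma language_rconsl w b : L (rcons w b) -> w = [::] \/ L w.
Proof.
case: w => [|a w] Lwb; [by left | right].
by apply: (@language_cat [::] _ [:: b]); rewrite // cat0s cats1.
Qed.

Lemma language_consr a w : L (a :: w) -> w <> [::] -> L w.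
Proof. by move=> Law; apply: (@language_cat [:: a] _ [::]); rewrite cats0. Qed.

Lemma language_nil : ~ L [::].
Proof. by move=> /languageP [x [i []]]. Qed.

Lemma language_left_extendable w : subshift X -> w = [::] \/ L w ->
  exists a, L (a :: w).
Proof.
move=> [[x0 Xx0] _ _] Lw.
have [x [i [Xx wE]]] : exists x i, X x /\ w = block x i (size w).
  case: Lw => [->|/languageP [x [i [Xx _ wE]]]]; first by exists x0, 0%R.
  by exists x, i.
exists (x (i - 1)%R); apply/languageP; exists x, (i - 1)%R; split => //.
by rewrite /= -add1n block_cat GRing.subrK -wE /block /= GRing.addr0.
Qed.

End Language.

Section Recurrence.
Variable A : finType.
Local Notation full := {ptws int -> discrete_topology A}.

Lemma full_shift_compact : compact [set: full].
Proof.
have cA (i : int) : compact [set: discrete_topology A].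
  by apply: finite_compact; exact: (@finite_finset A).
have := @tychonoff int (fun=> discrete_topology A) (fun=> setT) cA.
have -> : [set f : forall i : int, discrete_topology A |
    forall i, [set: discrete_topology A] (f i)] = setT by apply/seteqP; split.
by [].
Qed.

Lemma open_coordinate i a : open ([set x | x i = a] : set full).
Proof.
have -> : ([set x | x i = a] : set full) =
  (fun x : full => x i : discrete_topology A) @^-1` [set a] by [].
apply: open_comp; last exact: discrete_open.
by move=> x _; exact: (@proj_continuous _ (fun=> discrete_topology A) i).
Qed.

Lemma block_cons (x : int -> A) i n : block x i n.+1 = x i :: block x (i + 1)%R n.
Proof. by rewrite -add1n block_cat /block /= GRing.addr0. Qed.

Lemma open_cylinder i (s : seq A) : open ([set x | block x i (size s) = s] : set full).
Proof.
elim: s i => [|a s IH] i.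
  have -> : ([set x | block x i (@size A [::]) = [::]] : set full) = setT.
    by apply/seteqP; split.
  exact: openT.
have -> : ([set x | block x i (size (a :: s)) = a :: s] : set full) =
    [set x | x i = a] `&` [set x | block x (i + 1)%R (size s) = s].
  apply/seteqP; split => x /=; rewrite block_cons; first by case.
  by move=> [-> ->].
by apply: openI; [exact: open_coordinate | exact: IH].
Qed.

Lemma block_shift (x : int -> A) i n : block (shift x) i n = block x (i + 1)%R n.
Proof. by apply: eq_map => k; rewrite /shift; congr (x _); lia. Qed.

(** Otherwise some points of X avoid s on larger and larger windows around the
    origin. A cluster point avoids s everywhere, and the points that do so form a
    subshift smaller than X. *)
Lemma minimal_subshift_uniformly_recurrent (X : set (int -> A)) (s : seq A) :
  minimal_subshift X -> language X s ->
  exists N, forall z, language X z -> (N <= size z)%N ->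
    exists x y, z = x ++ s ++ y.
Proof.
move=> [[X0 clX shX] minX] /languageP [x0 [i0 [Xx0 _ sE]]].
pose Y := [set x | X x /\ forall i, block x i (size s) <> s].
have Y0 : ~ (Y !=set0).
  move=> Yn; suff YX : Y = X.
    have [_ /(_ i0)] : Y x0 by rewrite YX.
    by rewrite -sE.
  apply: minX; last by move=> x [].
  split => //.
    have -> : (Y : set full) =
        (X : set full) `&` \bigcap_(i in [set: int]) ~` [set x | block x i (size s) = s].
      apply/seteqP; split => x [Xx nx]; split => //.
        by move=> i _; exact: nx.
      by move=> i; exact: (nx i I).
    apply: closedI => //; apply: closed_bigI => i _.
    by rewrite closedC; exact: open_cylinder.
  apply/seteqP; split => [_ [x [Xx nx] <-]|x [Xx nx]].
    split; first by rewrite -shX; exists x.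
    by move=> i; rewrite block_shift.
  have [y Xy yx] : (@shift A @` X) x by rewrite shX.
  exists y => //; split => // i.
  by have := nx (i - 1)%R; rewrite -yx block_shift GRing.subrK.
have cX : compact (X : set full).
  by apply: (subclosed_compact clX full_shift_compact).
apply: contrapT => nN.
have {nN} bad m : exists x, X x /\
    forall i : int, (- m%:Z <= i <= m%:Z)%R -> block x i (size s) <> s.
  apply: contrapT => nx; apply: nN; exists (m + m + size s)%N => z.
  move=> /languageP [x [i [Xx _ zE]]] sz; apply: contrapT => nz; apply: nx.
  (* A word z of length at least 2m + |s| that avoids s occurs at position i of x;
     translating x by i + m centres it at the origin. *)
  have shiftX : forall n y, X y -> exists t, X t /\ forall j, t j = y (j + n%:Z)%R.
    elim=> [|n IH] y Xy; first by exists y; split => // j; rewrite GRing.addr0.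
    have [t [Xt tE]] := IH y Xy; exists (shift t); split.
      by rewrite -shX; exists t.
    by move=> j; rewrite /shift tE; congr (y _); lia.
  have shiftXN : forall n y, X y -> exists t, X t /\ forall j, t j = y (j - n%:Z)%R.
    elim=> [|n IH] y Xy; first by exists y; split => // j; rewrite GRing.subr0.
    have [t [Xt tE]] := IH y Xy.
    have [t' Xt' t'E] : (@shift A @` X) t by rewrite shX.
    exists t'; split => // j; have := congr1 (fun f => f (j - 1)%R) t'E.
    by rewrite /shift GRing.subrK tE => ->; congr (y _); lia.
  have [t [Xt tE]] : exists t, X t /\ forall j, t j = x (j + (i + m%:Z))%R.
    case: (i + m%:Z)%R => n; first exact: shiftX.
    by have [t [Xt tE]] := shiftXN n.+1 x Xx; exists t.
  exists t; split => // j jm tj; apply: nz.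
  pose k := absz (j + m%:Z)%R; have kE : (k%:Z = j + m%:Z)%R by lia.
  have tk : block x (i + k%:Z)%R (size s) = s.
    rewrite -[RHS]tj; apply: eq_map => l; rewrite tE; congr (x _); lia.
  exists (block x i k), (block x (i + k%:Z + (size s)%:Z)%R (size z - k - size s)).
  rewrite -[X in _ ++ X ++ _]tk -block_cat -block_cat.
  by rewrite [LHS]zE; congr (block _ _ _); lia.
have [xs xsP] := choice bad.
have FF : ProperFilter (xs @ \oo) by exact: fmap_proper_filter.
have [|x [Xx xcl]] := cX (xs @ \oo) FF.
  by exists 0%N => // m _; have [] := xsP m.
have [i ix] : exists i, block x i (size s) = s.
  apply: contrapT => ni; apply: Y0; exists x; split => // i ix.
  by apply: ni; exists i.
have nx : nbhs (x : full) ([set y | block y i (size s) = s] : set full).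
  by apply: open_nbhs_nbhs; split => //; exact: open_cylinder.
have [|y [[m im <-] ym]] := xcl (xs @` [set m | (absz i <= m)%N]) _ _ nx.
  by exists (absz i) => // m /= im; exists m.
have [_ /(_ i) nb] := xsP m; apply: nb ym.
by move: im => /=; lia.
Qed.

End Recurrence.

Lemma lettersP (A : finType) (X : set (int -> A)) a :
  a \in letters X <-> language X [:: a].
Proof.
split=> [/asboolP [x [i [Xx <-]]]|[x [i [n [Xx E]]]]].
  by exists x, i, 0%N; rewrite /block /= GRing.addr0.
apply/asboolP; exists x, i; split => //.
by move: E; rewrite block_cons => -[].
Qed.

(** * Consequences of the tree condition *)

(** A path from x to y that avoids the edge xy would form a cycle with it. *)
Lemma acyclic_edge_disconnects (T : finType) (r : rel T) (x y : T) :
  symmetric r -> irreflexive r ->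
  (forall c : seq T, ucycle r c -> (size c <= 2)%N) -> r x y ->
  ~~ connect [rel u v | r u v && ((u, v) \notin [:: (x, y); (y, x)])] x y.
Proof.
move=> rsym rirr rcyc rxy; apply/negP => /connectP [p0 pth lasty].
case: (shortenP pth) lasty => p pth' up _ lasty.
have rpth : path r x p by apply: sub_path pth' => u v /andP [].
have : (size (x :: p) <= 2)%N.
  by apply: rcyc; rewrite /ucycle up /cycle rcons_path rpth -lasty rsym rxy.
case: p pth' lasty {up rpth} => [|z [|//]] /= pth' lasty.
  by move: rxy; rewrite lasty rirr.
by move: pth'; rewrite -lasty !inE eqxx andbF.
Qed.

(** Removing an edge xy of a forest separates x from y, so a potential for the
    other edges can be corrected along xy by a constant on the side of y. *)
Lemma forest_potential (T : finType) (K : groupType) (r : rel T) (d : T -> T -> K) :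
  symmetric r -> irreflexive r ->
  (forall c : seq T, ucycle r c -> (size c <= 2)%N) ->
  (forall x y, r x y -> d y x = (d x y)^-1)%g ->
  exists f : T -> K, forall x y, r x y -> (d x y = (f x)^-1 * f y)%g.
Proof.
elim: {r}_.+1 {-2}r (ltnSn #|[pred p : T * T | r p.1 p.2]|) => // n IH r.
rewrite ltnS => rn rsym rirr rcyc dsym.
have [[x [y rxy]]|nr] := pselect (exists x y, r x y); last first.
  by exists (fun=> 1%g) => x y rxy; case: nr; exists x, y.
pose r' := [rel u v | r u v && ((u, v) \notin [:: (x, y); (y, x)])].
have r'sym : symmetric r'.
  move=> u v; rewrite /= rsym !inE !xpair_eqE.
  by rewrite orbC ![(u == _) && _]andbC.
have nxy : ~~ connect r' x y by exact: acyclic_edge_disconnects.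
have [] := IH r' _ r'sym.
- apply: leq_trans rn; apply: proper_card; apply/properP; split.
    by apply/fintype.subsetP => p; rewrite !inE /= => /andP [].
  by exists (x, y); [rewrite inE | rewrite !inE /= rxy mem_head].
- by move=> u /=; rewrite rirr.
- move=> c /andP [cc uc]; apply: rcyc; rewrite /ucycle uc andbT.
  by case: c cc {uc} => //= a c; apply: sub_path => u v /andP [].
- by move=> u v /andP [/dsym].
move=> f fP; pose k := (f x * d x y * (f y)^-1)%g.
exists (fun z => if connect r' y z then k * f z else f z)%g => u v ruv.
have [r'uv|] := boolP (r' u v).
  rewrite (fP _ _ r'uv) -(same_connect_r (sym_connect_sym r'sym) (@connect1 _ r' u v r'uv)).
  by case: ifP => // _; rewrite invgM -mulgA mulKg.
have cyx : connect r' y x = false.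
  by rewrite (sym_connect_sym r'sym); exact: negbTE.
rewrite /= ruv /= negbK !inE !xpair_eqE => /orP [] /andP [/eqP -> /eqP ->].
  by rewrite cyx connect0 /k mulgVK mulKg.
by rewrite cyx connect0 /k mulgVK invgM mulgVK dsym.
Qed.

Section TreeCondition.
Variables (A : finType) (X : set (int -> A)).
Local Notation L := (language X).
Hypothesis treeX : tree_condition X.

(** The extension graph of w is acyclic, so the labels of the words awb come from
    a potential f w on its vertices. A word of length n + 1 is a vertex of two
    extension graphs, on the right for its prefix and on the left for its
    suffix; comparing the two potentials labels it, and this labelling is
    cohomologous to the given one. Descending to n = 0 leaves a labelling of the
    letters. *)
Lemma labelling_cohomologous_to_letters (K : groupType) n (c : seq A -> K) :
  exists (alpha : A -> K) (h : seq A -> K), forall z b, size z = n ->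
    L (rcons z b) ->
    c (rcons z b) = ((h z)^-1 * alpha b * h (behead (rcons z b)))%g.
Proof.
elim: n c => [|n IH] c.
  exists (fun b => c [:: b]), (fun=> 1%g) => z b /size0nil -> _ /=.
  by rewrite invg1 mul1g mulg1.
have [f fP] : exists f : seq A -> A + A -> K, forall w a b,
    w = [::] \/ L w -> L (a :: rcons w b) ->
    c (a :: rcons w b) = ((f w (inl a))^-1 * f w (inr b))%g.
  pose P w (fw : A + A -> K) := forall a b, L (a :: rcons w b) ->
    c (a :: rcons w b) = ((fw (inl a))^-1 * fw (inr b))%g.
  have ex w : exists fw, w = [::] \/ L w -> P w fw.
    have [Lw|nLw] := pselect (w = [::] \/ L w); last by exists (fun=> 1%g).
    have [_ _ cyc] := treeX Lw.
    pose d (p q : A + A) : K := match p, q with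
      | inl a, inr b => c (a :: rcons w b)
      | inr b, inl a => (c (a :: rcons w b))^-1
      | _, _ => 1 end%g.
    have [||||fw fwP] := @forest_potential _ K (ext_adj X w) d.
    - by move=> [a|a] [b|b].
    - by move=> [a|a].
    - exact: cyc.
    - by move=> [a|a] [b|b] //= _; rewrite invgK.
    by exists fw => _ a b Lawb; apply: (fwP (inl a) (inr b)); apply/asboolP.
  by have [f fP] := choice ex; exists f => w a b Lw; exact: fP.
pose p u : K := if u is a :: u' then f u' (inl a) else 1%g.
pose c' u : K := if u is a :: u' then
  (f (belast a u') (inr (last a u')) * (p u)^-1)%g else 1%g.
have [alpha [h hP]] := IH c'.
exists alpha, (fun u => h (behead u) * p u)%g => -[//|a w] b [szw] Lawb /=.
have Lwb : L (rcons w b) by apply: (language_consr Lawb); case: (w).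
have Lw := language_rconsl Lwb.
rewrite (fP _ _ _ Lw Lawb).
have := hP w b szw Lwb.
have -> : c' (rcons w b) = (f w (inr b) * (p (rcons w b))^-1)%g.
  case: (w) => [|x v] //=.
  by rewrite belast_rcons last_rcons.
move=> /(congr1 (fun t => t * p (rcons w b))%g); rewrite mulgVK => ->.
by rewrite invgM !mulgA.
Qed.

End TreeCondition.

Section Equivariance.
Variables (A : finType) (X : set (int -> A)).
Local Notation L := (language X).
Hypothesis treeX : tree_condition X.
Hypothesis left_extendable : forall w, w = [::] \/ L w -> exists a, L (a :: w).

(** On the edge awb of the extension graph of w, equivariance links h(aw) to
    h(wb). As this graph is connected, h(aw) is the same for all a, so h comes
    from a map on words one letter shorter; descend to the empty word. *)
Lemma equivariant_map_constant (Q : Type) (rho : A -> Q -> Q) n (h : seq A -> Q) :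
  (forall b, injective (rho b)) ->
  (forall z b, size z = n -> L (rcons z b) ->
     h (behead (rcons z b)) = rho b (h z)) ->
  exists q, (forall z, size z = n -> z = [::] \/ L z -> h z = q) /\
    forall b, L [:: b] -> rho b q = q.
Proof.
move=> rhoI; elim: n h => [|n IH] h hP.
  exists (h [::]); split => [z /size0nil -> //|b Lb].
  by have /= := hP [::] b erefl Lb.
have [a0 _] : exists a, L [:: a] by apply: left_extendable; left.
have /choice [la laP] w : exists a, w = [::] \/ L w -> L (a :: w).
  have [/left_extendable [a Law]|nLw] := pselect (w = [::] \/ L w).
    by exists a.
  by exists a0.
pose h' w := h (la w :: w).
pose on_vertex w (p : A + A) := match p with
  | inl a => h (a :: w) = h' w
  | inr b => h (rcons w b) = rho b (h' w)
  end.
have edge w p q : size w = n -> ext_adj X w p q -> on_vertex w p -> on_vertex w q.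
  move=> sw; case: p q => [a|b] [a'|b'] //= /asboolP /= Lawb pE.
    by rewrite -pE -(hP (a :: w) b') //= sw.
  by apply: (rhoI b); rewrite -pE -(hP (a' :: w) b) //= sw.
have vertexP w p : size w = n -> w = [::] \/ L w -> ext_vertices X w p ->
    on_vertex w p.
  move=> sw Lw Vp; have [_ con _] := treeX Lw.
  have /connectP [s pth ->] := con (inl (la w)) p (laP w Lw) Vp.
  have : on_vertex w (inl (la w)) by [].
  elim: s (inl (la w)) pth => //= q s IHs p0 /andP [p0q qs] p0P.
  by apply: IHs qs _; exact: edge p0q p0P.
have hcons a w : size w = n -> L (a :: w) -> h (a :: w) = h' w.
  move=> sw Law; apply: (vertexP w (inl a)) => //.
  by case: w {sw} Law => [|b w] Law; [left | right; exact: language_consr Law _].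
have [z b sz Lzb|q [hq rq]] := IH h'.
  rewrite -(vertexP z (inr b)) //; last exact: language_rconsl Lzb.
  move: Lzb sz; case: z => [|c z] /= Lzb sz.
    by rewrite (hcons b).
  by rewrite (hcons c) // size_rcons.
exists q; split => // -[//|a w] [sw] [//|Law].
rewrite hcons // hq //.
by case: (w) Law => [|b v] Law; [left | right; exact: language_consr Law _].
Qed.

End Equivariance.

(** * Finite images of the Schutzenberger group *)

Section SchutzenbergerGroup.
Variables (A : finType) (X : set (int -> A)).
Variables (F : topologicalSemigroupType) (eta : A -> F) (e : F).
Local Notation L := (language X).
Local Notation W := (wval eta e).
Hypothesis freeF : free_profinite_semigroup eta.
Hypothesis minX : minimal_subshift X.
Hypothesis treeX : tree_condition X.
Hypothesis eK : (e * e = e)%g.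
Hypothesis units_cl : forall g, units_at e g -> closure (W @` L) g.
Hypothesis cl_factor : forall x, closure (W @` L) x -> Defs.factor x e.

Let unit_e : units_at e e.
Proof. by split => //; exists e. Qed.

Let unitsM x y : units_at e x -> units_at e y -> units_at e (x * y)%g.
Proof. exact: (subgroup_units_at eK).1. Qed.

Let subX : subshift X. Proof. by case: minX. Qed.

Let left_extendable w : w = [::] \/ L w -> exists a, L (a :: w).
Proof. exact: language_left_extendable. Qed.

Let Lfact x y z : L (x ++ y ++ z) -> y <> [::] -> L y.
Proof. exact: language_cat. Qed.

Let long_word N : exists2 z, L z & size z = N.+1.
Proof.
have [[x Xx] _ _] := subX; exists (block x 0%R N.+1); last by rewrite size_block.
by exists x, 0%R, N.
Qed.

(** All words of length N + 1 of X contain s. An occurrence of s in zb that lies in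
    z and one that lies in the suffix of length N + 1 of zb are two occurrences in
    the same word, hence comparable up to phi(H). The length N + 1 keeps z
    nonempty. *)
Lemma occurrence_cocycle (T : topologicalSemigroupType) (phi : F -> T) :
  finite_discrete T -> continuous_hom phi ->
  exists s N (U V : seq A -> seq A),
    [/\ L s /\ phi (W s) = phi e,
      forall z, L z -> size z = N.+1 -> z = U z ++ s ++ V z &
      forall z b, L (rcons z b) -> size z = N.+1 -> exists2 g, units_at e g &
        (act (phi \o eta) (phi e) (V z) * phi (eta b) =
         phi g * act (phi \o eta) (phi e) (V (behead (rcons z b))))%g].
Proof.
move=> fT hphi; have proF := freeF.1.
have [s [Ls se ret]] := returns_into_units proF (@language_nil _ X) eK
  (units_cl unit_e) cl_factor fT hphi.
have [N0 NP] := minimal_subshift_uniformly_recurrent minX Ls.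
have /choice [UV UVP] z : exists uv : seq A * seq A,
    L z -> size z = N0.+1 -> z = uv.1 ++ s ++ uv.2.
  have [[Lz sz]|nz] := pselect (L z /\ size z = N0.+1).
    by have [|x [y xy]] := NP z Lz; [rewrite sz | exists (x, y)].
  by exists ([::], [::]) => Lz sz; case: nz.
exists s, N0, (fun z => (UV z).1), (fun z => (UV z).2); split => // z b Lzb sz.
have Lz : L z by have [z0|//] := language_rconsl Lzb; rewrite z0 in sz.
case: z sz Lz Lzb => // c z /= [sz] Lz Lzb.
have Lz' : L (rcons z b) by apply: language_consr Lzb _; case: (z).
have sz' : size (rcons z b) = N0.+1 by rewrite size_rcons sz.
have zE := UVP _ Lz (congr1 S sz); have z'E := UVP _ Lz' sz'.
have s0 : s <> [::] by move=> s0; apply: (@language_nil _ X); rewrite -s0.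
have wE : (UV (c :: z)).1 ++ s ++ rcons (UV (c :: z)).2 b =
    (c :: (UV (rcons z b)).1) ++ s ++ (UV (rcons z b)).2.
  by rewrite /= -z'E -cats1 catA catA -(catA _ s) -zE cats1.
have Lw : L ((UV (c :: z)).1 ++ s ++ rcons (UV (c :: z)).2 b).
  by rewrite wE /= -z'E.
have [g Hg gE] := returns_comparable eK hphi Lfact s0 ret Lw wE.
by exists g => //; rewrite -gE act_rcons.
Qed.

(** The cosets of chi(H) by the chi(V z) form an equivariant map on words, which
    is therefore a single coset, stable under right multiplication by the
    letters. *)
Lemma letters_in_image (K : topologicalGroupType) (chi : F -> K) a :
  finite_discrete K -> continuous_hom chi -> L [:: a] ->
  exists2 g, units_at e g & chi g = chi (eta a).
Proof.
move=> fK hchi La; have [_ chiM] := hchi.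
have chi_e : chi e = 1%g.
  by apply: (mulgI (chi e)); rewrite mulg1 -chiM eK.
have unitsV g : units_at e g -> exists2 g', units_at e g' & chi g' = (chi g)^-1%g.
  move=> Hg; have [eg ge [w [ew we gw wg]]] := Hg.
  exists w; first by split => //; exists g.
  by apply: (mulgI (chi g)); rewrite mulgV -chiM gw.
have [s [N [U [V [_ VP Vb]]]]] := occurrence_cocycle fK hchi.
pose t z := act (chi \o eta) 1%g (V z).
pose h z : set K := [set k | exists2 g, units_at e g & k = (chi g * t z)%g].
pose rho b (Q : set K) : set K := [set k | Q (k * (chi (eta b))^-1)%g].
have rhoI b : injective (rho b).
  move=> Q Q' QQ'; apply/seteqP; split=> k Qk.
    have : rho b Q (k * chi (eta b))%g by rewrite /rho /= mulgK.
    by rewrite QQ' /rho /= mulgK.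
  have : rho b Q' (k * chi (eta b))%g by rewrite /rho /= mulgK.
  by rewrite -QQ' /rho /= mulgK.
have hP z b : size z = N.+1 -> L (rcons z b) ->
    h (behead (rcons z b)) = rho b (h z).
  move=> sz Lzb; have [g Hg] := Vb z b Lzb sz.
  rewrite chi_e -/(t _) -/(t _) => gE.
  have [g' Hg' g'E] := unitsV g Hg.
  apply/seteqP; split=> k [g1 Hg1 kE].
    exists (g1 * g')%g; first exact: unitsM.
    rewrite kE chiM g'E -!mulgA; congr (_ * _)%g.
    apply: (mulgI (chi g)); rewrite mulgA -gE -mulgA mulgV mulg1.
    by rewrite mulgA mulgV mul1g.
  exists (g1 * g)%g; first exact: unitsM.
  by rewrite chiM -mulgA -gE mulgA -kE mulgVK.
have [q [hq rhoq]] :=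
  equivariant_map_constant treeX left_extendable rhoI hP.
have [z Lz sz] := long_word N.
have qE : q = h z by rewrite hq //; right.
have qb b k : L [:: b] -> q k -> q (k * chi (eta b))%g.
  by move=> Lb qk; rewrite -(rhoq b Lb) /rho /= mulgK.
have qt : q (t z) by rewrite qE; exists e => //; rewrite chi_e mul1g.
(* The coset q of t z is stable under the letters, hence under t z itself, which
   is a product of letters; so t z lies in chi(H) and q = chi(H). *)
have qtt : q (t z * t z)%g.
  have q_act v : (forall b, b \in v -> L [:: b]) -> forall k, q k ->
      q (act (chi \o eta) k v).
    elim: v => //= b v IH Lv k qk; apply: IH => [c cv|]; last first.
      by apply: qb => //; apply: Lv; rewrite mem_head.
    by apply: Lv; rewrite in_cons cv orbT.
  rewrite {2}/t -actM mulg1; apply: q_act => // b bV.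
  have [v1 [v2 vE]] : exists v1 v2, V z = v1 ++ b :: v2.
    by case/splitPr: bV => v1 v2; exists v1, v2.
  apply: (@Lfact (U z ++ s ++ v1) _ v2) => //.
  by rewrite -!catA /= -vE -VP.
have [g Hg gE] : exists2 g, units_at e g & t z = chi g.
  by move: qtt; rewrite qE => -[g Hg /mulIg tE]; exists g.
have q1 : q 1%g.
  have [g' Hg' g'E] := unitsV g Hg; rewrite qE; exists g' => //.
  by rewrite g'E gE mulVg.
have := qb a 1%g La q1; rewrite mul1g qE => -[g' Hg' ->].
by exists (g' * g)%g; [exact: unitsM | rewrite chiM gE].
Qed.

(** Reading a word after z multiplies phi(e)phi(V z) by a cocycle with values in
    the finite group phi(H). As this cocycle is cohomologous to a labelling of the
    letters, phi(u) only depends on the prefix and the suffix of length N + 1 of u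
    and on the image of u under a homomorphism chi to phi(H). Words close to an
    element of H have the same prefix and the same suffix as words close to e,
    so on H only chi matters. *)
Lemma image_determined_by_group (T : topologicalSemigroupType) (phi : F -> T) :
  finite_discrete T -> continuous_hom phi ->
  exists (K : topologicalGroupType) (chi : F -> K), [/\ finite_discrete K,
    continuous_hom chi & forall g g', units_at e g -> units_at e g' ->
      chi g = chi g' -> phi g = phi g'].
Proof.
move=> fT hphi; have [cphi phiM] := hphi; have proF := freeF.1.
have subK := image_subgroup phiM (subgroup_units_at eK).
have compK : compact (phi @` units_at e).
  by apply: finite_compact; apply: sub_finite_set fT.1.
have [K [j [isoK _ _]]] :=
  compact_subgroup_group subK compK (finite_discrete_hausdorff fT).
have fK := topological_group_iso_finite_discrete fT isoK.
have [jI jrange jM _] := isoK.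
have j_image g : units_at e g -> exists k, j k = phi g.
  move=> Hg; have : range j (phi g) by rewrite jrange; exists g.
  by case=> k _; exists k.
have j1 : j 1%g = phi e.
  have [k ke] := j_image e unit_e; rewrite -ke; congr j.
  by apply: (mulgI k); rewrite mulg1; apply: jI; rewrite jM ke -phiM eK.
have [s [N [U [V [[Ls se] VP Vb]]]]] := occurrence_cocycle fT hphi.
pose f := phi \o eta; pose t z := act f (phi e) (V z).
have e_act v : (phi e * act f (phi e) v = act f (phi e) v)%g.
  by rewrite -actM -phiM eK.
pose label_of w k := forall z b, w = rcons z b -> L w -> size z = N.+1 ->
  (t z * phi (eta b) = j k * t (behead w))%g.
have /choice [c cP] w : exists k, label_of w k.
  case/lastP: w => [|z b]; first by exists 1%g => z b; case: z.
  have [[Lzb sz]|nz] := pselect (L (rcons z b) /\ size z = N.+1); last first.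
    by exists 1%g => z' b' /rcons_inj [<- <-] Lzb sz; case: nz.
  have [g Hg gE] := Vb z b Lzb sz; have [k kE] := j_image g Hg.
  by exists k => z' b' /rcons_inj [<- <-] _ _; rewrite kE.
have [alpha [h hP]] := labelling_cohomologous_to_letters treeX N.+1 c.
have [chi [hchi chiE]] := free_profinite_extend alpha freeF
  (finite_discrete_profinite_semigroup fK).
exists K, chi; split => //.
(* last_block w is the suffix of length N + 1 of w, where a path of the graph of
   words of length N + 1 that reads w ends. *)
pose last_block w : seq A := drop (size w - N.+1) w.
have path_value y z : size z = N.+1 -> L (z ++ y) ->
    act f (phi e) (V z ++ y) =
    (j (act alpha (h z)^-1 y * h (last_block (z ++ y))) *
     t (last_block (z ++ y)))%g.
  move=> sz; elim/last_ind: y => [|y b IH].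
    by rewrite !cats0 /last_block sz subnn drop0 mulVg j1 e_act.
  rewrite -!rcons_cat => Lzyb.
  have Lzy : L (z ++ y).
    by have [zy0|//] := language_rconsl Lzyb; move: sz; case: (z) zy0.
  set w := z ++ y in Lzy Lzyb IH *.
  have sw : (N.+1 <= size w)%N by rewrite size_cat sz leq_addr.
  have sl : size (last_block w) = N.+1 by rewrite size_drop subKn.
  have lE : behead (rcons (last_block w) b) = last_block (rcons w b).
    rewrite /last_block size_rcons subSn // -drop_rcons ?leq_subr //.
    by rewrite -drop1 drop_drop add1n.
  have Llb : L (rcons (last_block w) b).
    apply: (@Lfact (take (size w - N.+1) w) _ [::]).
      by rewrite cats0 -rcons_cat cat_take_drop.
    by move=> /(congr1 size); rewrite size_rcons.
  rewrite act_rcons IH // -mulgA (cP _ _ _ erefl Llb sl) mulgA -jM lE.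
  rewrite (hP _ _ sl Llb) lE act_rcons !mulgA mulgK.
  by [].
have value u : L u -> (N.+1 <= size u)%N -> let z := take N.+1 u in
    phi (W u) = (phi (W (U z ++ s)) *
      (j ((h z)^-1 * (chi (W z))^-1 * chi (W u) * h (last_block u)) *
       t (last_block u)))%g.
  move=> Lu su z; have sz : size z = N.+1 by rewrite size_takel.
  have uE : u = z ++ drop N.+1 u by rewrite cat_take_drop.
  have z0 : z <> [::] by move=> z0; rewrite z0 in sz.
  have Lz : L z by apply: (@Lfact [::] _ (drop N.+1 u)); rewrite // cat0s -uE.
  have zE := VP z Lz sz.
  have s0 : s <> [::] by move=> s0; apply: (@language_nil _ X); rewrite -s0.
  have Us0 : U z ++ s <> [::] by case: (U z) => //; case: (s) s0.
  have Us_e : (phi (W (U z ++ s)) * phi e = phi (W (U z ++ s)))%g.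
    case: (U z) => [|a v]; first by rewrite cat0s se -phiM eK.
    by rewrite wval_cat // -(mul_wval _ e) // phiM -mulgA se -(phiM e e) eK.
  have chiW x v : chi (act eta x v) = act alpha (chi x) v.
    rewrite (act_hom _ _ _ hchi.2); congr act.
    by apply/funext => b; rewrite /= chiE.
  have -> : phi (W u) = (phi (W (U z ++ s)) * act f (phi e) (V z ++ drop N.+1 u))%g.
    rewrite -actM Us_e -(act_hom _ _ _ phiM) -wval_cat //.
    by rewrite -catA (catA s) (catA (U z)) -zE -uE.
  have -> : chi (W u) = act alpha (chi (W z)) (drop N.+1 u).
    by rewrite {1}uE wval_cat // chiW.
  by rewrite path_value -?uE // -(actM alpha) mulgVK.
have [p [q [pqM pqo pqe]]] := prefix_suffix_extend N freeF.
have pW u : u <> [::] -> p (W u) = take N.+1 u.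
  case/lastP: u => // u b _; elim/last_ind: u b => [|u a IH] b.
    by rewrite /= (pqe b).1.
  rewrite -cats1 wval_cat; last by case: (u).
  by rewrite /= (pqM _ _).1 IH (pqe b).1 take_catl.
have qW u : u <> [::] -> q (W u) = take N.+1 (rev u).
  case/lastP: u => // u b _; elim/last_ind: u b => [|u a IH] b.
    by rewrite /= (pqe b).2.
  rewrite -cats1 wval_cat; last by case: (u).
  by rewrite /= (pqM _ _).2 IH (pqe b).2 rev_cat take_catr.
(* The prefix and the suffix of the idempotent e have full length, since they
   are unchanged when e is doubled. *)
have idem (P : F -> seq A) : P e = take N.+1 (P e ++ P e) -> P e <> [::] ->
    size (P e) = N.+1.
  move=> PE P0; have := congr1 size PE; rewrite size_take size_cat.
  by case: ltnP => //; case: (P e) P0 => //= a l _; lia.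
have approx g : units_at e g -> exists u, [/\ L u, phi (W u) = phi g,
    chi (W u) = chi g, p (W u) = p g & q (W u) = q g].
  move=> Hg; have nb (B : set F) : open B -> B g -> nbhs g B.
    by move=> oB Bg; apply: open_nbhs_nbhs.
  have := units_cl Hg.
  move=> /(_ ([set x | phi x = phi g] `&` [set x | chi x = chi g] `&`
    [set x | p x = p g] `&` [set x | q x = q g])) [].
    apply: filterI; last by apply: nb => //; exact: (pqo g).2.
    apply: filterI; last by apply: nb => //; exact: (pqo g).1.
    apply: filterI.
      have := @eventually_eq_finite_image F T F (nbhs g) _ id g phi cphi fT; apply; exact: cvg_id.
    have := @eventually_eq_finite_image F K F (nbhs g) _ id g chi hchi.1 fK; apply; exact: cvg_id.
  by move=> _ [[u Lu <-] [[[? ?] ?] ?]]; exists u.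
have Lnil u : L u -> u <> [::] by move=> Lu u0; apply: (@language_nil _ X); rewrite -u0.
have [ue [/Lnil ue0 _ _ pue que]] := approx e unit_e.
have spe : size (p e) = N.+1.
  apply: (idem p); first by rewrite -(pqM e e).1 eK.
  by rewrite -pue pW //; case: (ue) ue0.
have sqe : size (q e) = N.+1.
  apply: (idem q); first by rewrite -(pqM e e).2 eK.
  by rewrite -que qW //; case/lastP: (ue) ue0 => // v b _; rewrite rev_rcons.
have same g : units_at e g -> p g = p e /\ q g = q e.
  move=> [eg ge _]; split; [rewrite -[in LHS]eg (pqM _ _).1 | rewrite -[in LHS]ge (pqM _ _).2];
    by rewrite take_size_cat.
have form g : units_at e g -> phi g = (phi (W (U (p e) ++ s)) *
    (j ((h (p e))^-1 * (chi (W (p e)))^-1 * chi g * h (rev (q e))) *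
       t (rev (q e))))%g.
  move=> Hg; have [u [Lu <- <- pu qu]] := approx g Hg.
  have [pg qg] := same g Hg; have u0 := Lnil u Lu.
  have take_u : take N.+1 u = p e by rewrite -pW // pu.
  have su : (N.+1 <= size u)%N.
    by rewrite -spe -take_u size_take_min geq_minr.
  have last_u : last_block u = rev (q e).
    by rewrite -qg -qu qW // /last_block take_rev revK.
  by rewrite value // take_u last_u.
by move=> g g' Hg Hg' chig; rewrite (form g Hg) (form g' Hg') chig.
Qed.

End SchutzenbergerGroup.

(** * Freeness *)

Section FreeBasis.
Variables (A : finType) (X : set (int -> A)).
Variables (F : topologicalSemigroupType) (eta : A -> F).
Variables (H : set F) (G : topologicalGroupType) (j : G -> F) (d : F).
Local Notation L := (language X).
Hypothesis freeF : free_profinite_semigroup eta.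
Hypothesis isoH : topological_group_iso H j.
Hypothesis compactG : compact [set: G].
Hypothesis hausG : hausdorff_space G.
Hypothesis H_cl : H `<=` closure (wval eta d @` L).
Hypothesis letters_realized : forall (K : topologicalGroupType) (chi : F -> K) a,
  finite_discrete K -> continuous_hom chi -> L [:: a] ->
  exists2 g, H g & chi g = chi (eta a).
Hypothesis separated : forall (T : topologicalSemigroupType) (phi : F -> T),
  finite_discrete T -> continuous_hom phi ->
  exists (K : topologicalGroupType) (chi : F -> K), [/\ finite_discrete K,
    continuous_hom chi & forall g g', H g -> H g' ->
      chi g = chi g' -> phi g = phi g'].

Let HjE : range j = H. Proof. by case: isoH. Qed.
Let Hj x : H (j x). Proof. by rewrite -HjE; exists x. Qed.
Let jM : {morph j : x y / (x * y)%g}. Proof. by case: isoH. Qed.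
Let jI : injective j. Proof. by case: isoH. Qed.

Let j_continuous : continuous j.
Proof. by apply/continuousP => V oV; case: isoH => _ _ _ ->; exists V. Qed.

Let H_separated g g' : H g -> H g' ->
  (forall (K : topologicalGroupType) (chi : F -> K),
    finite_discrete K -> continuous_hom chi -> chi g = chi g') -> g = g'.
Proof.
move=> Hg Hg' eqg; apply: contrapT; have [[_ _ sepF] _] := freeF.
move=> /sepF [T [phi [fT hphi]]]; apply.
by have [K [chi [fK hchi]]] := separated fT hphi; apply => //; exact: eqg.
Qed.

(** Finite semigroup images separate the points of H, hence so do the finite group
    images that determine them on H. *)
Lemma iso_profinite_group : profinite_group G.
Proof.
split=> // x y xy; have [[_ _ sepF] _] := freeF.
have [|T [phi [fT hphi phixy]]] := sepF (j x) (j y); first by move=> /jI.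
have [K [chi [fK [cchi chiM] chiP]]] := separated fT hphi.
exists K, (chi \o j); split => //; last by move=> /chiP e; apply: phixy; apply: e.
split; last by move=> u v /=; rewrite jM chiM.
by move=> u; apply: continuous_comp; [exact: j_continuous | exact: cchi].
Qed.

(** A letter is congruent to an element of H in every finite group image of F,
    so by compactness a single element of H does for all of them. *)
Lemma basis_element_exists a : L [:: a] -> exists x : G,
  forall (K : topologicalGroupType) (chi : F -> K),
    finite_discrete K -> continuous_hom chi -> chi (j x) = chi (eta a).
Proof.
move=> La.
have [|K chi fK hchi|x _ xP] := @compact_realizes_finite_images F G j setT (eta a)
  j_continuous compactG; last by exists x.
  by exists 1%g.
have [g Hg gE] := letters_realized fK hchi La.
have [x _ xg] : range j g by rewrite HjE.
by exists x => //; rewrite xg.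
Qed.

(** Two continuous homomorphisms on G that agree on the basis agree on a compact
    set closed under products. In each finite group image of F, a given element
    of H agrees with some word of X, hence with an element of this set; so it
    belongs to the set by compactness and separation. *)
Lemma free_profinite_group_on_letters :
  free_profinite_group_of_rank #|letters X| G.
Proof.
have Lval (i : 'I_#|letters X|) : L [:: enum_val i] by apply/lettersP/enum_valP.
have /choice [basis basisP] i := basis_element_exists (Lval i).
exists basis; split; first exact: iso_profinite_group.
move=> P proP f; have [cP hP sepP] := proP.
(* The letters outside X may be sent anywhere. *)
pose fbar a := if [pick i : 'I_#|letters X| | enum_val i == a] is Some i
  then f i else 1%g.
have fbarE i : fbar (enum_val i) = f i.
  rewrite /fbar; case: pickP => [i' /eqP /enum_val_inj ->//|/(_ i)].
  by rewrite eqxx.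
have [fhat [[cfhat fhatM] fhatE]] :=
  free_profinite_extend fbar freeF (profinite_group_semigroup proP).
have htheta : continuous_hom (fhat \o j).
  split; last by move=> x y /=; rewrite jM fhatM.
  by move=> x; apply: continuous_comp; [exact: j_continuous | exact: cfhat].
have basisE i : fhat (j (basis i)) = f i.
  apply: contrapT => /sepP [T [g [fT [cg gM] []]]].
  rewrite -fbarE -fhatE; apply: (basisP i T (g \o fhat) fT); split.
    by move=> x; apply: continuous_comp; [exact: cfhat | exact: cg].
  by move=> x y /=; rewrite fhatM gM.
exists (fhat \o j); split => // theta [[ctheta thetaM] thetaE].
pose agree := [set x | fhat (j x) = theta x].
have agreeM x y : agree x -> agree y -> agree (x * y)%g.
  by rewrite /agree /= jM fhatM thetaM => -> ->.
have agree_basis i : agree (basis i) by rewrite /agree /= basisE thetaE.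
have compact_agree : compact agree.
  rewrite compact_ultra => V UV VA.
  have [x [_ Vx]] : exists x : G, setT x /\ id @ V --> x.
    by apply: (@ultra_lim _ V G _ _ setT compactG); apply: filterS VA.
  exists x; split => //; apply: (@eventually_eq_lim P G V _ (fhat \o j) theta) => //.
  - by apply: (cvg_comp _ (fhat \o j) Vx); exact: htheta.1.
  - by apply: (cvg_comp _ theta Vx); exact: ctheta.
apply/funext => x /=.
suff [y Ay yP] : exists2 y, agree y &
    forall (K : topologicalGroupType) (chi : F -> K),
    finite_discrete K -> continuous_hom chi -> chi (j y) = chi (j x).
  by rewrite -(jI (H_separated (Hj y) (Hj x) yP)).
apply: compact_realizes_finite_images => // [|K chi fK hchi].
  exists 1%g; rewrite /agree /=; apply: (mulgI (theta 1%g)).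
  rewrite -thetaM mulg1; apply: (mulIg (fhat (j 1%g))).
  by rewrite -mulgA -fhatM -jM mulg1.
have := H_cl (Hj x); move=> /(_ [set z | chi z = chi (j x)]) [].
  have := @eventually_eq_finite_image F K F (nbhs (j x)) _ id (j x) chi hchi.1 fK.
  by apply; exact: cvg_id.
move=> _ [[u Lu <-] /= <-].
have letter b : L [:: b] -> exists2 y, agree y & chi (j y) = chi (eta b).
  move=> /lettersP bX; exists (basis (enum_rank_in bX b)); first exact: agree_basis.
  by rewrite basisP // enum_rankK_in.
case: u Lu => [/language_nil //|b u].
elim/last_ind: u => [|u c IH] Lu; first exact: letter.
have Lc : L [:: c].
  by apply: (@language_cat _ _ (b :: u) _ [::]) => //; rewrite cats0 cats1.
have Lbu : L (b :: u).
  by apply: (@language_cat _ _ [::] _ [:: c]) => //; rewrite /= cats1.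
have [y Ay yE] := IH Lbu; have [z Az zE] := letter c Lc.
exists (y * z)%g; first exact: agreeM.
by rewrite /= act_rcons jM !hchi.2 yE zE.
Qed.

End FreeBasis.

Theorem theorem6p5 (A : finType) (X : set (int -> A))
    (F : topologicalSemigroupType) (eta : A -> F)
    (J H : set F) :
  free_profinite_semigroup eta ->
  minimal_subshift X ->
  tree_condition X ->
  subshift_J_class eta X J ->
  maximal_subgroup H ->
  H `<=` J ->
  exists (G : topologicalGroupType) (j : G -> F),
    free_profinite_group_of_rank #|letters X| G /\ topological_group_iso H j.
Proof.
move=> freeF minX treeX [_ J_cl cl_factor] maxH HJ.
have [e [eK HE]] := maximal_subgroup_units maxH.
have proF := freeF.1; have [_ hF _] := proF.
have clE : language_image eta X = wval eta e @` language X.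
  apply/seteqP; split => [_ [[a u] /= Lau <-]|_ [[|a u] Lu <-]].
  - by exists (a :: u).
  - by case: (@language_nil _ X).
  - by exists (a, u).
have He : H e by rewrite HE; split => //; exists e.
have units_cl g : units_at e g -> closure (wval eta e @` language X) g.
  by rewrite -HE -clE => /HJ/J_cl.
have factor_e x : closure (wval eta e @` language X) x -> Defs.factor x e.
  by rewrite -clE => /cl_factor; apply; exact: HJ.
have compactH : compact H by rewrite HE; exact: compact_units_at.
have [G [j [isoH cG hG]]] := compact_subgroup_group maxH.1 compactH hF.
exists G, j; split => //.
apply: (@free_profinite_group_on_letters A X F eta H G j e) => //.
- by rewrite HE => g; exact: units_cl.
- by rewrite HE => K chi a; exact: (letters_in_image freeF minX treeX eK units_cl factor_e).
- by rewrite HE => T phi; exact: (image_determined_by_group freeF minX treeX eK units_cl factor_e).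
Qed.
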